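(* Let $c, d \in \mathbb{N}$. (i) If $c \mid k!\, S(d,k)$ for all $k \in \{2,\dots,d\}$, then every hypergraph $\mathcal{H}$ satisfies $$\operatorname{disc}(\Delta^d \mathcal{H}, c) \le \operatorname{disc}(\mathcal{H}, c).$$ (ii) If $k \in \{2,\dots,d\}$ is such that $c \nmid k!\, S(d,k)$, then there exists a hypergraph $\mathcal{K}$ such that $$\operatorname{disc}(\Delta^d \mathcal{K}, c) \ge \frac{1}{3\, k!}\, \operatorname{disc}(\mathcal{K}, c)^k,$$ and $\mathcal{K}$ can be chosen to have arbitrarily large discrepancy $\operatorname{disc}(\mathcal{K},c)$; that is, for every $r \in \mathbb{R}$ there is a hypergraph $\mathcal{K}$ satisfying this inequality and $\operatorname{disc}(\mathcal{K},c) \ge r$.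
   Context: $\mathbb{N}$ denotes the positive integers and $[c] = \{1,\dots,c\}$. $S(d,k)$ is the Stirling number of the second kind, i.e. the number of partitions of $[d]$ into $k$ non-empty subsets. A hypergraph is a pair $\mathcal{H} = (V,\mathcal{E})$ with $V$ a finite set and $\mathcal{E} \subseteq 2^V$; elements of $\mathcal{E}$ are called hyperedges. For $d\in\mathbb{N}$ its $d$-fold symmetric product is the hypergraph $\Delta^d\mathcal{H} = (V^d, \{E^d : E \in \mathcal{E}\})$. For $c\in\mathbb{N}$, a $c$-coloring of $\mathcal{H}$ is a map $\chi: V \to [c]$. Define $$\operatorname{disc}(\mathcal{H},\chi) = \max_{E \in \mathcal{E}} \max_{i \in [c]} \left| |\chi^{-1}(i) \cap E| - \tfrac1c |E| \right|, \qquad \operatorname{disc}(\mathcal{H},c) = \min_{\chi: V \to [c]} \operatorname{disc}(\mathcal{H},\chi).$$ *)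

(* Defs.v *)
From mathcomp Require Import all_boot all_order all_algebra.
From mathcomp Require Import reals.

Set Implicit Arguments.
Unset Strict Implicit.
Unset Printing Implicit Defensive.

Import Order.TTheory GRing.Theory Num.Theory.
Local Open Scope ring_scope.

Definition stirling2 (d k : nat) : nat :=
  #|[set P : {set {set 'I_d}} | partition P [set: 'I_d] & #|P| == k]|.

Record hypergraph : Type := Hypergraph {
  vertex : finType;
  hyperedges : {set {set vertex}}
}.

Definition set_power (V : finType) (d : nat) (E : {set V}) :
    {set {ffun 'I_d -> V}} :=
  [set x : {ffun 'I_d -> V} | [forall i, x i \in E]].

Definition sym_product (d : nat) (H : hypergraph) : hypergraph :=
  @Hypergraph {ffun 'I_d -> vertex H}
    [set set_power d E | E in hyperedges H].

Definition coloring (H : hypergraph) (c : nat) : finType :=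
  {ffun vertex H -> 'I_c}.

(* The maxima are over nonnegative numbers, so the unit 0 only matters for a
   hypergraph without hyperedges, whose discrepancy is 0 by convention. *)
Definition disc_coloring (R : realType) (H : hypergraph) (c : nat)
    (chi : coloring H c) : R :=
  \big[Num.max/0]_(E in hyperedges H) \big[Num.max/0]_(i < c)
    `| #|(chi @^-1: [set i]) :&: E|%:R - c%:R^-1 * #|E|%:R |.

(* The initial value of the minimum is itself the discrepancy of a coloring;
   the junk value 0 is taken only when there is no coloring at all, which
   requires c = 0. *)
Definition disc (R : realType) (H : hypergraph) (c : nat) : R :=
  if [pick chi : coloring H c] is Some chi0 then
    \big[Num.min/disc_coloring R chi0]_(chi : coloring H c) disc_coloring R chi
  else 0.

Lemma disc_le (R : realType) (H : hypergraph) (c : nat) (chi : coloring H c) :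
  disc R H c <= disc_coloring R chi.
Proof.
rewrite /disc; case: pickP => [chi0 _|/(_ chi)//].
exact: bigmin_le_cond.
Qed.

Lemma disc_attained (R : realType) (H : hypergraph) (c : nat) :
  (0 < c)%N -> exists chi : coloring H c, disc R H c = disc_coloring R chi.
Proof.
move=> c_gt0; rewrite /disc; case: pickP => [chi0 _|].
  elim/big_ind: _ => [|x y [f ->] [g ->]|chi _]; first by exists chi0.
    by rewrite /Num.min; case: ifP => _; [exists f | exists g].
  by exists chi.
by move=> /(_ [ffun=> Ordinal c_gt0]).
Qed.

(* Main.v *)
Require Import Defs.
From mathcomp Require Import all_boot all_order all_algebra.
From mathcomp Require Import reals.
From mathcomp Require Import ring lra zify.

Set Implicit Arguments.
Unset Strict Implicit.
Unset Printing Implicit Defensive.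

Import Order.TTheory GRing.Theory Num.Theory.
Local Open Scope ring_scope.

(** Sort the tuples of [V^d] by their image.  The tuples with image a given
    [S] form the class [onto d S], which has [k`! * stirling2 d k] elements for
    [k = #|S|] ([card_onto]), and [E^d] is the disjoint union of the classes
    with [S \subset E] ([card_power_onto]).  Hence the deviation of a coloring
    on [E^d] is a sum over the subsets [S] of [E] of the deviations on the
    classes [onto d S] ([discrepancy_onto]).

    If [c] divides every [k`! * stirling2 d k] with [2 <= k <= d], each class
    with [#|S| >= 2] can be split evenly among the colors.  The classes of
    singletons are the diagonal points, which receive an optimal coloring of
    [H]; then the deviation on [E^d] is exactly the one of that coloring on [E]
    ([disc_sym_product_le]).

    Otherwise take for [K] all [e]-subsets of a very large set.  Any
    coloring of the vertices has a color class containing a hyperedge, so the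
    discrepancy of [K] is between [e - e / c] and [e].  Given a coloring of
    [V^d], label each set [S] of at most [d] vertices by the number of
    occurrences of each color in [onto d S].  By Ramsey's theorem there is a
    hyperedge [T] inside which this label depends only on [#|S|]
    ([homogeneous_tuples]).  For each color the deviation on [T^d] is then a
    linear combination of the binomial coefficients ['C(e, j)], [j <= d], with
    coefficients [h j - (j`! * stirling2 d j) / c], [h j] an integer.  Let [n] be
    the largest [j] for which this coefficient is nonzero for some color.
    Then [n >= k], since [c] does not divide [k`! * stirling2 d k].  The
    coefficient is at least [1 / c] in absolute value, so if [n > k] the term
    ['C(e, n) / c] exceeds [e^k] for large [e].  If [n = k] the coefficient can
    even be taken at least [1 / 2] ([deviation_ge_half]), and
    ['C(e, k) / 2], which is about [e^k / (2 * k`!)], leaves room for the terms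
    of lower degree above [e^k / (3 * k`!)]. *)

(** * Tuples sorted by their image *)

Section Surjections.
Local Open Scope nat_scope.
Variables (d : nat) (V : finType).
Implicit Types (S E : {set V}) (X : {set {ffun 'I_d -> V}}).

Definition onto S : {set {ffun 'I_d -> V}} :=
  [set x : {ffun 'I_d -> V} | x @: [set: 'I_d] == S].

(** A surjection onto [S] with kernel partition [P] amounts to a bijection from
    the blocks of [P] to [S]; [phi] below turns the latter into the former. *)
Lemma card_onto_partition S (P : {set {set 'I_d}}) :
  partition P [set: 'I_d] -> #|P| = #|S| ->
  #|[set x : {ffun 'I_d -> V} |
      (x \in onto S) && (preim_partition x [set: 'I_d] == P)]| = #|S|`!.
Proof.
move=> partP cardPS; have [/eqP covP tiP P0] := and3P partP.
pose D : finType := {B : {set 'I_d} | B \in P}.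
have cardD : #|D| = #|S| by rewrite card_sig.
have blockP i : pblock P i \in P by rewrite pblock_mem // covP inE.
pose b i : D := exist _ (pblock P i) (blockP i).
have bE i j : (b i == b j) = (j \in pblock P i).
  by rewrite -val_eqE /= eq_pblock // covP inE.
have bsurj (B : D) : {i | b i = B}.
  case: B => B PB; have [i Bi] : {i | i \in B}.
    by apply/sigW/set0Pn; apply: contraNneq P0 => <-.
  by exists i; apply/val_inj; rewrite /= (def_pblock tiP PB Bi).
pose phi (g : {ffun D -> V}) : {ffun 'I_d -> V} := [ffun i => g (b i)].
have phi_inj : injective phi.
  move=> g h /ffunP gh; apply/ffunP=> B; have [i <-] := bsurj B.
  by have := gh i; rewrite !ffunE.
have cardfact : #|S| ^_ #|D| = #|S|`! by rewrite cardD ffactnn.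
rewrite -cardfact -card_inj_ffuns_on -(card_imset _ phi_inj).
apply: eq_card => x; rewrite inE [x \in onto S]inE; apply/andP/imsetP.
  case=> /eqP xS /eqP xP.
  have bx i j : (x i == x j) = (b i == b j).
    rewrite bE -xP /preim_partition.
    by rewrite pblock_equivalence_partition ?inE // => ? ? ? _ _ _; split=> // /eqP->.
  pose g : {ffun D -> V} := [ffun B => x (sval (bsurj B))].
  exists g; last first.
    apply/ffunP=> i; rewrite !ffunE; case: (bsurj _) => j /= /eqP.
    by rewrite -bx => /eqP->.
  rewrite !inE; apply/andP; split.
    by apply/ffun_onP=> B; rewrite ffunE -xS imset_f ?inE.
  apply/injectiveP=> A B; rewrite !ffunE => /eqP.
  by rewrite bx (svalP (bsurj A)) (svalP (bsurj B)) => /eqP.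
case=> g; rewrite !inE => /andP[/ffun_onP gS /injectiveP g_inj] ->.
split.
  have gimS : g @: [set: D] = S.
    apply/eqP; rewrite eqEcard card_imset // cardsT cardD leqnn andbT.
    by apply/subsetP=> _ /imsetP[B _ ->]; apply: gS.
  rewrite eqEsubset; apply/andP; split; apply/subsetP=> v.
    by case/imsetP=> i _ ->; rewrite ffunE; apply: gS.
  rewrite -gimS => /imsetP[B _ ->]; have [i <-] := bsurj B.
  by apply/imsetP; exists i; rewrite ?ffunE ?inE.
apply/eqP; rewrite -[RHS](equivalence_partition_pblock partP).
apply: eq_in_imset => i _; apply/setP=> j; rewrite !inE !ffunE /=.
by rewrite (inj_eq g_inj) bE.
Qed.

Lemma card_preim_partition (x : {ffun 'I_d -> V}) :
  #|preim_partition x [set: 'I_d]| = #|x @: [set: 'I_d]|.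
Proof.
have -> : preim_partition x [set: 'I_d] =
          (fun v => x @^-1: [set v]) @: (x @: [set: 'I_d]).
  rewrite -imset_comp; apply: eq_imset => i /=.
  by apply/setP=> j; rewrite !inE /= eq_sym.
apply: card_in_imset => u v /imsetP[i _ ->] /imsetP[j _ ->] /setP/(_ i).
by rewrite !inE eqxx => /esym/eqP.
Qed.

(** Grouping the surjections by kernel gives the factor [stirling2]. *)
Lemma card_onto S : #|onto S| = #|S|`! * stirling2 d #|S|.
Proof.
rewrite mulnC /stirling2 -sum_nat_const -sum1_card.
rewrite (partition_big (fun x : {ffun _} => preim_partition x [set: 'I_d])
  (mem [set P : {set {set 'I_d}} | partition P [set: 'I_d] & #|P| == #|S|])) /=.
  apply: eq_bigr => P; rewrite inE => /andP[partP /eqP cP].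
  by rewrite -(card_onto_partition partP cP) sum1dep_card.
move=> x; rewrite !inE preim_partitionP => /eqP <-.
by rewrite card_preim_partition eqxx.
Qed.

Lemma card_power_onto X E :
  #|X :&: set_power d E| = \sum_(S : {set V} | S \subset E) #|X :&: onto S|.
Proof.
rewrite -sum1_card.
rewrite (partition_big (fun x : {ffun _} => x @: [set: 'I_d])
          (fun S : {set V} => S \subset E)) /=.
  apply: eq_bigr => S SE; rewrite sum1dep_card; apply: eq_card => x.
  rewrite !inE -andbA; congr (_ && _).
  apply/andP/idP => [[] // |/eqP xS]; split; last by rewrite xS.
  by apply/forallP=> i; apply: (subsetP SE); rewrite -xS imset_f.
move=> x; rewrite !inE => /andP[_ /forallP xE].
by apply/subsetP=> _ /imsetP[i _ ->].
Qed.

Lemma onto_eq0 S : d < #|S| -> onto S = set0.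
Proof.
move=> dS; apply/setP=> x; rewrite !inE; apply: contraTF dS => /eqP <-.
by rewrite -leqNgt (leq_trans (leq_imset_card _ _)) // cardsT card_ord.
Qed.

Lemma onto_set0 : 0 < d -> onto set0 = set0.
Proof.
move=> d_gt0; apply/setP=> x; rewrite !inE imset_eq0.
by apply/negP => /eqP/setP/(_ (Ordinal d_gt0)); rewrite !inE.
Qed.

Lemma onto_set1 v : 0 < d -> onto [set v] = [set [ffun=> v]].
Proof.
move=> d_gt0; apply/setP=> x; rewrite !inE; apply/eqP/eqP=> [xv|->].
  by apply/ffunP=> i; rewrite ffunE; apply/set1P; rewrite -xv imset_f.
apply/setP=> u; rewrite inE; apply/imsetP/eqP => [[i _ ->]|->].
  by rewrite ffunE.
by exists (Ordinal d_gt0); rewrite ?ffunE.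
Qed.
End Surjections.
Arguments onto d {V} S.

(** * Ramsey's theorem *)
Section Ramsey.
Local Open Scope nat_scope.

Lemma subset_of_card (V : finType) (A : {set V}) n : n <= #|A| ->
  exists2 T : {set V}, T \subset A & #|T| = n.
Proof.
rewrite -bin_gt0 -cards_draws card_gt0 => /set0Pn[T].
by rewrite inE => /andP[TA /eqP]; exists T.
Qed.

Definition homogeneous (V : finType) (C : Type) (j : nat) (f : {set V} -> C)
    (T : {set V}) (a : C) :=
  forall S : {set V}, S \subset T -> #|S| = j -> f S = a.

(** The Erdős–Szekeres recursion for [j]-subsets.  Prescribing a size [m a] for
    each color [a] is what makes the induction on [j], then on [\sum_a m a],
    go through. *)
Lemma ramsey (C : finType) j (m : C -> nat) :
  exists N, forall (V : finType) (A : {set V}) (f : {set V} -> C), N <= #|A| ->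
  exists a (T : {set V}), [/\ T \subset A, #|T| = m a & homogeneous j f T a].
Proof.
elim: j m => [|j IHj] m.
  exists (\max_a m a) => V A f NA.
  have [T TA cT] := subset_of_card (leq_trans (leq_bigmax (f set0)) NA).
  by exists (f set0), T; split=> // S _ /cards0_eq ->.
have [n] := ubnP (\sum_a m a); elim: n m => // n IHn m.
rewrite ltnS => le_mn.
have [/existsP[a /eqP ma0]|/existsPn m_neq0] := boolP [exists a, m a == 0].
  exists 0 => V A f _; exists a, set0; rewrite sub0set cards0; split=> // S.
  by rewrite subset0 => /eqP ->; rewrite cards0.
pose m' a b := if b == a then (m b).-1 else m b.
have lt_m' a : \sum_b m' a b < n.
  apply: leq_trans le_mn; rewrite (bigD1 a) // [ltnRHS](bigD1 a) //= /m' eqxx.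
  rewrite -addSn prednK ?lt0n //; apply: leq_add => //.
  by apply: leq_sum => b /negPf->.
have /fin_all_exists[N HN] a := IHn _ (lt_m' a).
(* The case of [j]-subsets is applied to the link of a vertex v, asking for a
   set large enough for every set of targets with one size lowered. *)
have [N0 HN0] := IHj (fun=> \max_a N a).
exists N0.+1 => V A f ltNA.
have [v Av] : exists v, v \in A by apply/card_gt0P; apply: leq_ltn_trans ltNA.
have le_NA : N0 <= #|A :\ v| by rewrite (cardsD1 v) Av in ltNA.
have [a [T' [T'A cT' homT']]] := HN0 V _ (fun S => f (v |: S)) le_NA.
(* Every [j.+1]-subset of v |: T' containing v has color a; either a set of
   another color is found in T', or v extends one of color a. *)
have [|b [T [TT' cT homT]]] := HN a V T' f; first by rewrite cT' leq_bigmax.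
have TA : T \subset A :\ v := subset_trans TT' T'A.
have TA' : T \subset A := subset_trans TA (subsetDl _ _).
have [ab|/negPf nab] := eqVneq b a; last first.
  by exists b, T; rewrite cT /m' nab.
rewrite {b}ab in cT homT; exists a, (v |: T); split.
- by rewrite subUset sub1set Av.
- have vT : v \notin T by apply: contraTN isT => /(subsetP TA); rewrite !inE eqxx.
  by rewrite cardsU1 vT cT /m' eqxx add1n prednK ?lt0n.
move=> S ST cS; have [Sv|nSv] := boolP (v \in S); last first.
  apply: homT => //; apply/subsetP=> u Su; have := subsetP ST u Su.
  by rewrite !inE => /predU1P[uv|//]; rewrite -uv Su in nSv.
rewrite -(setD1K Sv); apply: homT'.
  apply: subset_trans TT'; apply/subsetP=> u; rewrite !inE => /andP[uv Su].
  by have := subsetP ST u Su; rewrite !inE (negPf uv).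
by apply/eqP; rewrite -eqSS -cS [in X in _ == X](cardsD1 v) Sv.
Qed.

(** Homogeneity passes to subsets, so the sizes can be treated successively. *)
Lemma ramsey_upto (C : finType) n m :
  exists N, forall (V : finType) (A : {set V}) (f : {set V} -> C), N <= #|A| ->
  exists T : {set V}, [/\ T \subset A, #|T| = m &
    forall j, j < n -> exists a, homogeneous j f T a].
Proof.
elim: n => [|n [N HN]].
  by exists m => V A f /subset_of_card[T TA cT]; exists T.
have [N' HN'] := @ramsey C n (fun=> N).
exists N' => V A f /(HN' V A f)[a [T' [T'A cT' homT']]].
have [|T [TT' cT homT]] := HN V T' f; first by rewrite cT'.
exists T; split=> //; first exact: subset_trans T'A.
move=> j; rewrite ltnS leq_eqVlt => /predU1P[-> |/homT //].
by exists a => S ST; apply: homT'; apply: subset_trans TT'.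
Qed.
End Ramsey.

(** * The case of even classes *)

Section Discrepancy.
Variable R : realType.

Lemma disc_coloring_ge (H : hypergraph) c (chi : coloring H c) E i :
  E \in hyperedges H ->
  `| #|(chi @^-1: [set i]) :&: E|%:R - c%:R^-1 * #|E|%:R | <= disc_coloring R chi.
Proof.
move=> HE; apply: le_trans (le_bigmax_cond _ _ HE).
by apply: (le_bigmax_cond _
  (fun i => `| #|(chi @^-1: [set i]) :&: E|%:R - c%:R^-1 * #|E|%:R |)).
Qed.

Lemma disc_coloring_le (H : hypergraph) c (chi : coloring H c) r : 0 <= r ->
  (forall E i, E \in hyperedges H ->
    `| #|(chi @^-1: [set i]) :&: E|%:R - c%:R^-1 * #|E|%:R | <= r) ->
  disc_coloring R chi <= r.
Proof.
move=> r_ge0 chi_r; apply: bigmax_le => // E HE; apply: bigmax_le => // i _.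
exact: chi_r.
Qed.

Lemma disc_coloring_ge0 (H : hypergraph) c (chi : coloring H c) :
  0 <= disc_coloring R chi.
Proof. exact: bigmax_ge_id. Qed.

Lemma discrepancy_onto d (V : finType) c (chi : {ffun 'I_d -> V} -> 'I_c)
    (E : {set V}) i :
  #|(chi @^-1: [set i]) :&: set_power d E|%:R - c%:R^-1 * #|set_power d E|%:R =
  \sum_(S : {set V} | S \subset E)
    (#|(chi @^-1: [set i]) :&: onto d S|%:R - c%:R^-1 * #|onto d S|%:R) :> R.
Proof.
rewrite -[in X in _ * X](setTI (set_power d E)) !card_power_onto !natr_sum.
rewrite mulr_sumr sumrB; congr (_ - _).
by apply: eq_bigr => S _; rewrite setTI.
Qed.

Lemma count_mod c n i : (i < c)%N ->
  count (fun j => j %% c == i)%N (iota 0 (n * c)) = n.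
Proof.
move=> lt_ic; have c_gt0 : (0 < c)%N by apply: leq_ltn_trans lt_ic.
elim: n => // n IHn; rewrite mulSn addnC iotaD count_cat IHn add0n -addn1.
congr (_ + _)%N; rewrite -[(n * c)%N]addn0 iotaDl count_map -(@eq_in_count _ (pred1 i)).
  by rewrite count_uniq_mem ?iota_uniq // mem_iota lt_ic.
by move=> j; rewrite mem_iota /= => lt_jc; rewrite modnMDl modn_small.
Qed.

(** Color the elements of [A] cyclically along an enumeration. *)
Lemma balanced_coloring (X : finType) (A : {set X}) c : (0 < c)%N ->
  (c %| #|A|)%N ->
  exists f : X -> 'I_c, forall i, (#|(f @^-1: [set i]) :&: A| * c = #|A|)%N.
Proof.
move=> c_gt0 /dvdnP[q cA].
exists (fun x => Ordinal (ltn_pmod (index x (enum A)) c_gt0)) => i.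
rewrite cA; congr (_ * _)%N; rewrite -[RHS](count_mod q (ltn_ord i)) -cA.
have -> : iota 0 #|A| = [seq index x (enum A) | x <- enum A].
  rewrite cardE; have [x0 _|] := pickP X; last first.
    by move=> X0; case: (enum A) => // x; have := X0 x.
  apply: (@eq_from_nth _ 0) => [|j]; rewrite size_iota ?size_map // => ltj.
  by rewrite (nth_map x0) // nth_iota // index_uniq ?enum_uniq.
rewrite count_map -size_filter cardE; apply/perm_size/uniq_perm.
- exact: enum_uniq.
- exact/filter_uniq/enum_uniq.
by move=> x; rewrite mem_enum mem_filter mem_enum !inE -val_eqE.
Qed.

(** In the coloring constructed here the class [onto d S] contributes nothing to
    the deviation on [E^d] unless [S] is a singleton [[set v]], and then as much
    as [v] contributes to the deviation of [chi] on [E]. *)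
Lemma disc_sym_product_le c d (H : hypergraph) : (0 < c)%N -> (0 < d)%N ->
  (forall k, (2 <= k <= d)%N -> (c %| k`! * stirling2 d k)%N) ->
  disc R (sym_product d H) c <= disc R H c.
Proof.
move=> c_gt0 d_gt0 c_dvd; have [chi ->] := disc_attained R H c_gt0.
have c_neq0 : c%:R != 0 :> R by rewrite pnatr_eq0 -lt0n.
pose w i v : R := (chi v == i)%:R - c%:R^-1.
have /fin_all_exists[f Hf] (S : {set vertex H}) :
    exists f : {ffun 'I_d -> vertex H} -> 'I_c, forall i,
      #|(f @^-1: [set i]) :&: onto d S|%:R - c%:R^-1 * #|onto d S|%:R =
      \sum_(v | S == [set v]) w i v :> R.
  have [cS|] := eqVneq #|S| 1%N.
    have /eqP/cards1P[v ->] := cS; exists (fun=> chi v) => i.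
    rewrite (big_pred1 v) => [|u]; last by rewrite (inj_eq set1_inj) eq_sym.
    rewrite onto_set1 // cards1 mulr1 /w; congr (_%:R - _).
    have [<-|nvi] := eqVneq (chi v) i.
      by rewrite (setIidPr _) ?cards1 // sub1set !inE.
    by apply/eqP; rewrite cards_eq0 setIC setI_eq0 disjoints1 !inE.
  move=> S_neq1.
  have cS : (c %| #|onto d S|)%N.
    have [->|S0] := eqVneq S set0; first by rewrite onto_set0 // cards0 dvdn0.
    have [lt_dS|le_Sd] := ltnP d #|S|; first by rewrite onto_eq0 // cards0 dvdn0.
    rewrite card_onto; apply: c_dvd; rewrite le_Sd andbT ltn_neqAle eq_sym S_neq1.
    by rewrite card_gt0.
  have [g Hg] := balanced_coloring c_gt0 cS.
  exists g => i; rewrite big_pred0 => [|v]; last first.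
    by apply: contraNF S_neq1 => /eqP->; rewrite cards1.
  by rewrite -(Hg i) natrM mulrC mulfK ?subrr.
pose chi' : coloring (sym_product d H) c :=
  [ffun x : {ffun 'I_d -> vertex H} => f (x @: [set: 'I_d]) x].
apply: le_trans (disc_le R chi') _; apply: disc_coloring_le => [|E' i].
  exact: disc_coloring_ge0.
case/imsetP=> E HE {E'}->; apply: le_trans (disc_coloring_ge chi i HE).
rewrite (discrepancy_onto chi').
have -> : \sum_(S : {set vertex H} | S \subset E)
    (#|(chi' @^-1: [set i]) :&: onto d S|%:R - c%:R^-1 * #|onto d S|%:R) =
    \sum_(v in E) w i v.
  transitivity (\sum_(S : {set vertex H} | S \subset E) \sum_(v | S == [set v]) w i v).
    apply: eq_bigr => S _; rewrite -Hf; congr (_%:R - _).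
    apply: eq_card => x; rewrite !inE ffunE.
    by apply: andb_id2r => /eqP->.
  rewrite (exchange_big_dep xpredT) //= [RHS]big_mkcond; apply: eq_bigr => v _.
  have [vE|vE] := boolP (v \in E).
    rewrite (big_pred1 [set v]) // => S /=; apply: andb_idl => /eqP->.
    by rewrite sub1set.
  rewrite big_pred0 // => S; apply: contraNF vE => /andP[SE /eqP ES].
  by rewrite -sub1set -ES.
rewrite sumrB sumr_const -[_ *+ #|E|]mulr_natr -natr_sum.
suff -> : \sum_(v in E) (chi v == i : nat) = #|(chi @^-1: [set i]) :&: E| by [].
rewrite -sum1_card big_mkcond [RHS]big_mkcond; apply: eq_bigr => v _.
by rewrite !inE andbC; case: (v \in E); case: eqP.
Qed.

End Discrepancy.

(** * The lower bound *)

Section LowerBound.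
Variable R : realType.

Lemma expn_le_ffact e n : (e ^ n.+1 <= e ^_ n.+1 + n.+1 ^ 2 * e ^ n)%N.
Proof.
elim: n => [|n IHn]; first by rewrite ffactn1 expn1 leq_addr.
have le_ffact : (e ^_ n.+1 <= e ^ n.+1)%N.
  elim: n.+1 => // m IHm; rewrite ffactnSr expnSr leq_mul //.
  exact: leq_subr.
have h1 : (e ^_ n.+1 * e <= e ^_ n.+1 * (e - n.+1) + e ^_ n.+1 * n.+1)%N.
  by rewrite -mulnDr leq_mul2l addnC -leq_subLR leqnn orbT.
have h2 : (e ^_ n.+1 * n.+1 <= n.+1 * e ^ n.+1)%N.
  by rewrite mulnC leq_mul2l le_ffact orbT.
have h3 : (e ^ n.+2 <= e ^_ n.+1 * e + n.+1 ^ 2 * e ^ n.+1)%N.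
  by rewrite expnSr [X in (_ ^ 2 * X)%N]expnSr mulnA -mulnDl leq_mul2r IHn orbT.
have h4 : (n.+1 * e ^ n.+1 + n.+1 ^ 2 * e ^ n.+1 <= n.+2 ^ 2 * e ^ n.+1)%N.
  by rewrite -mulnDl leq_mul2r; apply/orP; right; rewrite -!mulnn; nia.
rewrite [(e ^_ n.+2)%N]ffactnSr; lia.
Qed.

(** A combination of binomial coefficients is dominated by its term of highest
    degree, the others being at most [e ^+ n] each up to their coefficient. *)
Lemma binomial_sum_ge (b : nat -> R) (n e : nat) (B delta : R) : (0 < e)%N ->
  \sum_(j < n.+1) `|b j| <= B -> 0 <= delta -> delta <= `|b n.+1| ->
  (delta * (e%:R - n.+1%:R ^+ 2) / n.+1`!%:R - B) * e%:R ^+ n <=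
  `|\sum_(j < n.+2) b j * 'C(e, j)%:R|.
Proof.
move=> e_gt0 sumB delta_ge0 le_delta; rewrite big_ord_recr /=.
have rest : `|\sum_(j < n.+1) b j * 'C(e, j)%:R| <= B * e%:R ^+ n.
  apply: le_trans (ler_norm_sum _ _ _) _.
  apply: le_trans (ler_wpM2r _ sumB); last by rewrite exprn_ge0.
  rewrite mulr_suml; apply: ler_sum => j _; rewrite normrM ler_wpM2l //.
  rewrite ger0_norm // -natrX ler_nat.
  apply: leq_trans (leq_pexp2l e_gt0 (ltn_ord j : (j <= n)%N)).
  apply: leq_trans (_ : e ^_ j <= _)%N; first by rewrite -bin_ffact leq_pmulr ?fact_gt0.
  by elim: (j : nat) => // m IHm; rewrite ffactnSr expnSr leq_mul // leq_subr.
have fact_gt0R : 0 < n.+1`!%:R :> R by rewrite ltr0n fact_gt0.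
have main : delta * (e%:R - n.+1%:R ^+ 2) / n.+1`!%:R * e%:R ^+ n <=
            `|b n.+1 * 'C(e, n.+1)%:R|.
  rewrite normrM [`|_%:R|]ger0_norm //.
  apply: le_trans (ler_wpM2r _ le_delta) => //.
  rewrite -!mulrA ler_wpM2l // mulrCA mulrC ler_pdivrMr // -natrM bin_ffact.
  have := expn_le_ffact e n; rewrite -(ler_nat R) natrD natrM !natrX exprS.
  by move: (e%:R ^+ n) => X; rewrite mulrBl -lerBlDr.
rewrite mulrBl; apply: le_trans (lerB main rest) _.
by rewrite addrC; apply: lerB_normD.
Qed.

(** Integers closer than [1 / 2] to a common value are all equal; the sum of [c]
    equal integers is divisible by [c]. *)
Lemma deviation_ge_half c (h : 'I_c -> nat) : (0 < c)%N ->
  ~~ (c %| \sum_i h i)%N ->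
  exists i, 1 / 2 <= `|(h i)%:R - c%:R^-1 * (\sum_i h i)%N%:R| :> R.
Proof.
move=> c_gt0; set M := (\sum_i h i)%N => ndvd.
have [/existsP[i Hi]|/existsPn small] :=
  boolP [exists i, 1 / 2 <= `|(h i)%:R - c%:R^-1 * M%:R| :> R]; first by exists i.
case/negP: ndvd; pose i0 := Ordinal c_gt0.
suff -> : M = (c * h i0)%N by apply: dvdn_mulr.
rewrite /M (eq_bigr (fun=> h i0)) ?sum_nat_const ?card_ord // => i _.
have := small i; have := small i0; rewrite -!ltNge !ltr_norml.
move=> /andP[a1 a2] /andP[b1 b2]; case: (ltngtP (h i) (h i0)) => //;
  by rewrite -(ler_nat R) -natr1 => ?; exfalso; lra.
Qed.

Lemma deviation_ge_inv c (h M : nat) : (0 < c)%N -> (c * h != M)%N ->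
  c%:R^-1 <= `|h%:R - c%:R^-1 * M%:R| :> R.
Proof.
move=> c_gt0 neq; have c0 : 0 < c%:R :> R by rewrite ltr0n.
rewrite -(ler_pM2l c0) mulfV ?gt_eqF // -[X in X * `|_|]gtr0_norm // -normrM.
rewrite mulrBr mulVKf ?gt_eqF // -natrM.
rewrite ler_normr; move: neq; rewrite neq_ltn => /orP[]; rewrite -(ler_nat R) -natr1;
 move=> ?; apply/orP; [right|left]; lra.
Qed.

(** Ramsey's theorem is applied to subsets [S] of [V] rather than to tuples,
    with the color statistics of [onto d S] as the color of [S].  That these
    are bounded independently of [V] is what makes the number of colors, hence
    [N], independent of [V]. *)
Lemma homogeneous_tuples d c e : (0 < c)%N -> (d <= e)%N ->
  exists N, forall (V : finType) (chi : {ffun 'I_d -> V} -> 'I_c), (N <= #|V|)%N ->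
  exists (T : {set V}) (h : 'I_c -> nat -> nat), [/\ #|T| = e,
    forall i (S : {set V}), S \subset T -> (#|S| <= d)%N ->
      #|(chi @^-1: [set i]) :&: onto d S| = h i #|S| &
    forall j, (j <= d)%N -> (\sum_i h i j = j`! * stirling2 d j)%N].
Proof.
move=> c_gt0 le_de.
pose B := (\sum_(j < d.+1) j`! * stirling2 d j)%N.
have [N HN] := ramsey_upto {ffun 'I_c -> 'I_B.+1} d.+1 e.
exists N => V chi; rewrite -cardsT.
pose f (S : {set V}) : {ffun 'I_c -> 'I_B.+1} :=
  [ffun i => inord #|(chi @^-1: [set i]) :&: onto d S|].
move=> /(HN V setT f)[T [_ cT homT]].
have /fin_all_exists[a Ha] (j : 'I_d.+1) : exists a, homogeneous j f T a.
  exact: homT.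
pose h i j : nat := a (inord j) i.
have Hh i (S : {set V}) : S \subset T -> (#|S| <= d)%N ->
      #|(chi @^-1: [set i]) :&: onto d S| = h i #|S|.
  move=> ST cS; rewrite /h -(Ha (inord #|S|) S) ?inordK // ffunE inordK // ltnS.
  apply: leq_trans (subset_leq_card (subsetIr _ _)) _.
  by rewrite card_onto /B (bigD1 (Ordinal (cS : (#|S| < d.+1)%N))) //= leq_addr.
exists T, h; split=> // j le_jd.
have [S] : exists S : {set V}, S \in [set S : {set V} | S \subset T & #|S| == j].
  by apply/card_gt0P; rewrite cards_draws cT bin_gt0 (leq_trans le_jd).
rewrite inE => /andP[ST /eqP cS]; rewrite -cS -card_onto -[RHS]sum1_card.
rewrite (partition_big chi xpredT) //=; apply: eq_bigr => i _.
rewrite -Hh ?cS // sum1dep_card; apply: eq_card => x.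
by rewrite !inE andbC.
Qed.

Lemma discrepancy_homogeneous d c (V : finType) (chi : {ffun 'I_d -> V} -> 'I_c)
    (T : {set V}) (h : nat -> nat) i :
  (forall S : {set V}, S \subset T -> (#|S| <= d)%N ->
     #|(chi @^-1: [set i]) :&: onto d S| = h #|S|) ->
  #|(chi @^-1: [set i]) :&: set_power d T|%:R - c%:R^-1 * #|set_power d T|%:R =
  \sum_(j < d.+1) ((h j)%:R - c%:R^-1 * (j`! * stirling2 d j)%N%:R)
     * 'C(#|T|, j)%:R :> R.
Proof.
move=> Hh; rewrite discrepancy_onto (bigID (fun S : {set V} => #|S| < d.+1)%N) /=.
rewrite [X in _ + X]big1 ?addr0 => [|S /andP[_]]; last first.
  by rewrite -leqNgt => dS; rewrite onto_eq0 // setI0 cards0 mulr0 subrr.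
rewrite (partition_big (fun S : {set V} => inord #|S| : 'I_d.+1) xpredT) //=.
apply: eq_bigr => j _; rewrite -cards_draws mulr_natr -sumr_const; apply: eq_big => [S|S].
  rewrite inE -andbA; congr (_ && _).
  apply/andP/eqP => [[lt_Sd /eqP <-]|cS]; first by rewrite inordK.
  by rewrite cS ltn_ord inord_val.
move=> /andP[/andP[ST lt_Sd] /eqP <-]; rewrite inordK //.
by rewrite Hh // card_onto.
Qed.


Definition complete_hypergraph (N e : nat) : hypergraph :=
  @Hypergraph 'I_N [set E : {set 'I_N} | #|E| == e].

Lemma disc_complete_le N e c : (0 < c)%N ->
  disc R (complete_hypergraph N e) c <= e%:R.
Proof.
move=> c_gt0; have [chi ->] := disc_attained R (complete_hypergraph N e) c_gt0.
apply: disc_coloring_le => // E i; rewrite inE => /eqP cE.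
have le_e : (#|(chi @^-1: [set i]) :&: E| <= e)%N.
  by rewrite -cE subset_leq_card // subsetIr.
have inv_le1 : c%:R^-1 * e%:R <= e%:R :> R.
  by rewrite ler_piMl // invf_le1 ?ltr0n // ler1n.
have inv_ge0 : 0 <= c%:R^-1 * e%:R :> R by rewrite mulr_ge0 ?invr_ge0.
have cnt_ge0 : 0 <= #|(chi @^-1: [set i]) :&: E|%:R :> R by [].
rewrite -(ler_nat R) in le_e; rewrite cE ler_norml; apply/andP; split; lra.
Qed.

(** By pigeonhole some color class contains a whole hyperedge. *)
Lemma disc_complete_ge N e c : (0 < c)%N -> (c * e <= N)%N ->
  e%:R - c%:R^-1 * e%:R <= disc R (complete_hypergraph N e) c.
Proof.
move=> c_gt0 le_N; have [chi ->] := disc_attained R (complete_hypergraph N e) c_gt0.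
have [i] : exists i, (e <= #|chi @^-1: [set i]|)%N.
  have [//|noi] := boolP [exists i, (e <= #|chi @^-1: [set i]|)%N]; first exact/existsP.
  have {}noi i : (#|chi @^-1: [set i]| < e)%N.
    by move/existsPn: noi => /(_ i); rewrite -ltnNge.
  have e_gt0 : (0 < e)%N := leq_ltn_trans (leq0n _) (noi (Ordinal c_gt0)).
  have : (N <= c * e.-1)%N.
    rewrite -[N in (N <= _)%N]card_ord -sum1_card (partition_big chi xpredT) //=.
    rewrite -[c in (_ <= c * _)%N]card_ord -sum_nat_const; apply: leq_sum => i _.
    rewrite sum1dep_card -ltnS prednK //; apply: leq_trans (noi i).
    by rewrite ltnS subset_leq_card //; apply/subsetP=> x; rewrite !inE.
  by move/(leq_trans le_N); rewrite leq_pmul2l // -ltnS prednK // ltnn.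
rewrite -bin_gt0 -cards_draws => /card_gt0P[E]; rewrite inE => /andP[Ei /eqP cE].
have HE : E \in hyperedges (complete_hypergraph N e) by rewrite inE cE.
apply: le_trans (disc_coloring_ge R chi i HE).
by rewrite (setIidPr Ei) cE ler_norm.
Qed.

(** The bound on [e] covers both cases of the proof, uniformly in the coloring:
    [3 * k ^ 2 + 6 * B * k`! <= e] makes a leading coefficient [1 / 2] in degree
    [k] sufficient, where [B] bounds the sum of the absolute values of the
    lower coefficients, and [n ^ 2 + B.+1 * n`! * c <= e] a leading coefficient
    [1 / c] in a degree [n] larger than [k]. *)
Lemma disc_sym_product_complete c d k e : (0 < c)%N -> (2 <= k <= d)%N ->
  ~~ (c %| k`! * stirling2 d k)%N ->
  (3 * d ^ 2 + 6 * (\sum_(j < d.+1) j`! * stirling2 d j).+1 * d`! * c <= e)%N ->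
  exists N0, forall N, (N0 <= N)%N ->
  e%:R ^+ k / (3 * k`!%:R) <= disc R (sym_product d (complete_hypergraph N e)) c.
Proof.
move=> c_gt0 /andP[k_ge2 le_kd] ndvd.
pose M j := (j`! * stirling2 d j)%N; rewrite -/(M k) in ndvd.
rewrite -/M; set B := (\sum_(j < d.+1) M j)%N => le_e.
have le_de : (d <= e)%N by apply: leq_trans le_e; nia.
have [N0 HN0] := @homogeneous_tuples d c e c_gt0 le_de.
exists N0 => N le_N.
have [chi ->] := disc_attained R (sym_product d (complete_hypergraph N e)) c_gt0.
have [|T [h [cT Hh sumh]]] := HN0 'I_N chi; first by rewrite card_ord.
(* P j: the binomial coefficient of degree j occurs for some color. *)
pose P j := (j <= d)%N && [exists i, c * h i j != M j]%N.
have Pk : P k.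
  rewrite /P le_kd; apply/existsP; exists (Ordinal c_gt0).
  by apply: contraNneq ndvd => <-; apply: dvdn_mulr.
have ubP j : P j -> (j <= d)%N by case/andP.
have [n /andP[le_nd /existsP[i1 Hi1]] n_max] := ex_maxnP (ex_intro _ k Pk) ubP.
have le_kn : (k <= n)%N := n_max k Pk.
pose b i j : R := (h i j)%:R - c%:R^-1 * (M j)%:R.
have c0 : 0 < c%:R :> R by rewrite ltr0n.
have b_gt i j : (n < j <= d)%N -> b i j = 0.
  move=> /andP[lt_nj le_jd]; have /eqP: (c * h i j = M j)%N.
    apply: contraTeq lt_nj => neq; rewrite -leqNgt n_max // /P le_jd.
    by apply/existsP; exists i.
  by rewrite -(eqr_nat R) natrM => /eqP E; rewrite /b -E mulKf ?subrr ?gt_eqF.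
have b_le i j : (j <= d)%N -> `|b i j| <= (M j)%:R.
  move=> le_jd; have: (h i j <= M j)%N by rewrite -[M j]sumh // (bigD1 i) //= leq_addr.
  rewrite -(ler_nat R) => le_hM.
  have : c%:R^-1 * (M j)%:R <= (M j)%:R :> R.
    by rewrite ler_piMl // invf_le1 ?ltr0n // ler1n.
  have : 0 <= c%:R^-1 * (M j)%:R :> R by rewrite mulr_ge0 ?invr_ge0.
  have : 0 <= (h i j)%:R :> R by [].
  rewrite /b ler_norml => ? ? ?; apply/andP; split; lra.
case: n => [|n] in le_nd Hi1 n_max le_kn b_gt *; first by lia.
have T_edge : set_power d T \in hyperedges (sym_product d (complete_hypergraph N e)).
  by apply: imset_f; rewrite inE cT.
have sum_b i : \sum_(j < n.+1) `|b i j| <= B%:R.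
  apply: le_trans (_ : \sum_(j < d.+1) `|b i j| <= _).
    rewrite (big_ord_widen_cond d.+1 xpredT (fun j => `|b i j|)) //; last exact: ltnW.
    rewrite big_mkcond; apply: ler_sum => j _; case: ifP => //.
  rewrite natr_sum; apply: ler_sum => j _; apply: b_le; exact: (ltn_ord j).
have e_gt0 : (0 < e)%N by lia.
suff [i [delta [delta_ge0 le_delta bound]]] : exists i delta,
    [/\ 0 <= delta, delta <= `|b i n.+1| &
      e%:R ^+ k / (3 * k`!%:R) <=
      (delta * (e%:R - n.+1%:R ^+ 2) / n.+1`!%:R - B%:R) * e%:R ^+ n].
  apply: le_trans (disc_coloring_ge R chi i T_edge).
  have -> := discrepancy_homogeneous (Hh i).
  have -> : \sum_(j < d.+1) b i j * 'C(#|T|, j)%:R =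
            \sum_(j < n.+2) b i j * 'C(e, j)%:R.
    rewrite cT.
    rewrite [RHS](big_ord_widen_cond d.+1 xpredT (fun j => b i j * 'C(e, j)%:R)) //.
    rewrite [RHS]big_mkcond; apply: eq_bigr => j _; case: ltnP => //= lt_nj.
    by rewrite b_gt ?mul0r // lt_nj -ltnS ltn_ord.
  exact: le_trans bound (binomial_sum_ge e_gt0 (sum_b i) delta_ge0 le_delta).
have le_fact : (n.+1`! <= d`!)%N := leq_fact le_nd.
have le_sqr : (n.+1 ^ 2 <= d ^ 2)%N by rewrite leq_sqr.
(* An opaque name, as arithmetic simplification would unfold the factorial. *)
have [F defF] : {F | F = n.+1`!} by exists n.+1`!.
rewrite -defF in le_fact *.
have F_gt0 : 0 < F%:R :> R by rewrite ltr0n defF fact_gt0.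
have [eq_kn|neq_kn] := eqVneq k n.+1.
  have [] := @deviation_ge_half c (fun i => h i k) c_gt0 _; first by rewrite sumh.
  move=> i; rewrite sumh // => le_half; exists i, (1 / 2).
  split; [by lra | by rewrite -eq_kn | ].
  have : (3 * n.+1 ^ 2 + 6 * B * F <= e)%N.
    apply: leq_trans le_e; rewrite leq_add ?leq_mul2l //.
    by rewrite -!mulnA leq_mul2l /= leq_mul // (leq_trans le_fact) // leq_pmulr.
  rewrite -(ler_nat R) natrD !natrM => le_eR.
  rewrite eq_kn -defF exprS mulrAC ler_wpM2r ?exprn_ge0 //.
  rewrite -(ler_pM2r F_gt0).
  rewrite [_ / (3 * _) * _](_ : _ = e%:R / 3); last by field; rewrite gt_eqF.
  rewrite [X in _ <= X](_ : _ = 1 / 2 * (e%:R - n.+1%:R ^+ 2) - B%:R * F%:R).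
    lra.
  by field; rewrite gt_eqF.
exists i1, c%:R^-1; split; first by rewrite invr_ge0.
  exact: deviation_ge_inv.
have : (n.+1 ^ 2 + B.+1 * F * c <= e)%N.
  apply: leq_trans le_e; rewrite leq_add //.
    by rewrite (leq_trans le_sqr) // leq_pmull.
  rewrite leq_mul2r -mulnA; apply/orP; right.
  by rewrite (leq_trans _ (leq_pmull _ _)) // leq_mul2l le_fact orbT.
rewrite -(ler_nat R) natrD !natrM -(natr1 B) => le_eR.
apply: le_trans (_ : e%:R ^+ n <= _).
  apply: le_trans (_ : e%:R ^+ k <= _); last by rewrite ler_weXn2l ?ler1n //; lia.
  rewrite ler_pdivrMr ?mulr_gt0 ?ltr0n ?fact_gt0 //.
  by rewrite ler_peMr ?exprn_ge0 // -natrM ler1n muln_gt0 fact_gt0.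
rewrite ler_peMl ?exprn_ge0 // lerBrDr ler_pdivlMr // [X in _ <= X]mulrC ler_pdivlMr //.
lra.
Qed.
End LowerBound.

Theorem theorem3 (R : realType) (c d : nat) (c_gt0 : (0 < c)%N)
    (d_gt0 : (0 < d)%N) :
  ((forall k : nat, (2 <= k <= d)%N -> (c %| k`! * stirling2 d k)%N) ->
    forall H : hypergraph, disc R (sym_product d H) c <= disc R H c)
  /\
  (forall k : nat, (2 <= k <= d)%N -> ~~ (c %| k`! * stirling2 d k)%N ->
    forall r : R, exists K : hypergraph,
      disc R (sym_product d K) c >= 1 / (3 * (k`!)%:R) * disc R K c ^+ k
      /\ disc R K c >= r).
Proof.
split=> [c_dvd H|k k_bounds ndvd r]; first exact: disc_sym_product_le.
set e0 := (3 * d ^ 2 + 6 * (\sum_(j < d.+1) j`! * stirling2 d j).+1 * d`! * c)%N.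
(* The second summand ensures r <= e / 2 <= e - e / c. *)
pose e := (e0 + 2 * (Num.truncn r).+1)%N.
have le_e : (e0 <= e)%N := leq_addr _ e0.
have [N0 HN0] := disc_sym_product_complete R c_gt0 k_bounds ndvd le_e.
pose N := maxn N0 (c * e).
exists (complete_hypergraph N e).
have disc_ge := disc_complete_ge R c_gt0 (leq_maxr N0 (c * e)).
have c_ge2 : (2 <= c)%N.
  by case: (c) c_gt0 ndvd => [|[|]] // _; rewrite dvd1n.
have disc_ge_r : r <= disc R (complete_hypergraph N e) c.
  apply: le_trans disc_ge.
  have : c%:R^-1 * e%:R <= 2^-1 * e%:R :> R.
    by rewrite ler_wpM2r // lef_pV2 ?posrE ?ltr0n // ler_nat.
  have : 2 * (Num.truncn r).+1%:R <= e%:R :> R by rewrite -natrM ler_nat leq_addl.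
  have := truncnS_gt r; lra.
split=> //; apply: le_trans (HN0 N (leq_maxl _ _)).
rewrite mul1r mulrC ler_wpM2r ?invr_ge0 ?mulr_ge0 //.
rewrite lerXn2r ?nnegrE ?disc_complete_le //.
apply: le_trans disc_ge; rewrite subr_ge0 ler_piMl // invf_le1 ?ltr0n //.
by rewrite ler1n.
Qed.
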